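(* Let $(X,T)$ be a minimal system and let $d\ge1$ be an integer. Then $\mathbf{RP}^{[d]}(X)$ is an equivalence relation on $X$.
   Context: A system $(X,T)$ is a compact metric space $X$ (metric $\rho$) with a homeomorphism $T:X\to X$; it is minimal if every orbit $\{T^nx:n\in\mathbb Z\}$ is dense. $\mathbf{RP}^{[d]}(X)$ (regionally proximal relation of order $d$) is the set of $(x,y)\in X\times X$ such that for every $\delta>0$ there are $x',y'\in X$ and $\mathbf n=(n_1,\dots,n_d)\in\mathbb Z^d$ with $\rho(x,x')<\delta$, $\rho(y,y')<\delta$ and $\rho(T^{\mathbf n\cdot\epsilon}x',T^{\mathbf n\cdot\epsilon}y')<\delta$ for all $\epsilon\in\{0,1\}^d\setminus\{(0,\dots,0)\}$, where $\mathbf n\cdot\epsilon=\sum_i n_i\epsilon_i$. *)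

(* Defs.v *)
From HB Require Import structures.
From mathcomp Require Import all_boot all_order all_algebra.
From mathcomp Require Import all_classical all_reals.
From mathcomp Require Import topology.

Set Implicit Arguments.
Unset Strict Implicit.
Unset Printing Implicit Defensive.

Import Order.TTheory GRing.Theory Num.Theory.

Local Open Scope classical_set_scope.
Local Open Scope ring_scope.

Record homeomorphism (X : topologicalType) := Homeomorphism {
  homeo_fun :> X -> X;
  homeo_inv : X -> X;
  homeo_funK : cancel homeo_fun homeo_inv;
  homeo_invK : cancel homeo_inv homeo_fun;
  homeo_fun_continuous : continuous homeo_fun;
  homeo_inv_continuous : continuous homeo_inv
}.

(* [Negz m] is the integer - (m + 1). *)
Definition homeo_iter (X : topologicalType) (T : homeomorphism X) (n : int)
    (x : X) : X :=
  match n with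
  | Posz m => iter m T x
  | Negz m => iter m.+1 (homeo_inv T) x
  end.

Definition orbit_of (X : topologicalType) (T : homeomorphism X) (x : X) :
  set X := range (fun n : int => homeo_iter T n x).

Definition minimal_system (X : topologicalType) (T : homeomorphism X) : Prop :=
  forall x : X, dense (orbit_of T x).

Definition cube_dot (d : nat) (n : {ffun 'I_d -> int})
    (eps : {ffun 'I_d -> bool}) : int :=
  \sum_(i < d) n i * (eps i)%:Z.

Definition RP (R : realType) (X : metricType R) (T : homeomorphism X)
    (d : nat) (x y : X) : Prop :=
  forall delta : R, 0 < delta ->
  exists (x' y' : X) (n : {ffun 'I_d -> int}),
    [/\ mdist x x' < delta,
        mdist y y' < delta &
        forall eps : {ffun 'I_d -> bool}, eps != [ffun=> false] ->
          mdist (homeo_iter T (cube_dot n eps) x')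
                (homeo_iter T (cube_dot n eps) y') < delta].

(* Main.v *)
(* Let Q^[d] be the closure in X^[d] = X^({0,1}^d) of the cubes
   (T^(m + n.eps) x)_eps, and let the face group Z^d act on X^[d], n acting on
   the vertex eps by T^(n.eps). The key fact, by induction on d: if a is in
   Q^[d] and a_0 = x, then the diagonal point x^[d] is in the closure of the
   face orbit of a.
   Write a = (p, q) in Q^[d+1] as two faces. By induction and compactness we
   may take p = x^[d], q = b. Let U be a neighbourhood of x^[d] and C the
   closure of {T^k h b : h x^[d] in U}. Induction gives that finitely many
   face translates of C cover Q^[d]; discarding redundant ones yields a
   T-invariant open set O and an h with h x^[d] in U, h b in O, and O /\ Q^[d]
   inside C. As (x^[d], b) is a limit of pairs (y, T^j y) with y in Q^[d],
   invariance of O and C turns h T^j y in O into h y in C, whence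
   h x^[d] in C: some T^k h' b is in U with h' x^[d] in U.
   If (x, y) is in RP^[d], a compactness argument and the key fact for d put
   (x, y, ..., y) in Q^[d+1], and the key fact for d + 1 sends (y, ..., y) to
   (x, ..., x) by face transformations off the base vertex; conversely this
   implies RP^[d](x, y), and it is transitive. *)

Require Import Defs.
From mathcomp Require Import all_boot all_order all_algebra.
From mathcomp Require Import all_classical all_reals.
From mathcomp Require Import topology.

Local Open Scope classical_set_scope.

Set Implicit Arguments.
Unset Strict Implicit.
Unset Printing Implicit Defensive.
Import Order.TTheory GRing.Theory Num.Theory.
Local Open Scope ring_scope.

(** * Closures, finite covers and projection along a compact factor *)

Section Topology.

Lemma closure_map (S U : topologicalType) (f : S -> U) (A : set S) (B : set U) :
  continuous f -> (forall a, A a -> closure B (f a)) ->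
  forall c, closure A c -> closure B (f c).
Proof.
move=> cf AB c Ac.
apply: (preimage_closed (D := closure B) _ (@closed_closure _ B)).
  by move=> x _; exact: cf.
exact: closureS Ac.
Qed.

Lemma closure_sub (S : topologicalType) (A B : set S) (c : S) :
  closure A c -> A `<=` B -> closure B c.
Proof. by move=> Ac AB; exact: closureS Ac. Qed.

Lemma closure_trans (S : topologicalType) (A B : set S) :
  A `<=` closure B -> closure A `<=` closure B.
Proof.
move=> AB c; apply: (closure_map (f := id)) => [x U|a /AB]; by [].
Qed.

Lemma continuous_pair (S U V : topologicalType) (f : S -> U) (g : S -> V) :
  continuous f -> continuous g -> continuous (fun x => (f x, g x)).
Proof. by move=> cf cg x; apply: cvg_pair; [exact: cf|exact: cg]. Qed.

Lemma continuous_fst (S U : topologicalType) :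
  continuous (fst : S * U -> S).
Proof. by move=> x; exact: cvg_fst. Qed.

Lemma continuous_snd (S U : topologicalType) :
  continuous (snd : S * U -> U).
Proof. by move=> x; exact: cvg_snd. Qed.

Lemma continuous_compose (S U V : topologicalType) (f : S -> U) (g : U -> V) :
  continuous f -> continuous g -> continuous (g \o f).
Proof. by move=> cf cg x; apply: continuous_comp; [exact: cf|exact: cg]. Qed.

(** Near-covering compactness is applied along the filter of index lists ordered by inclusion: near
    each point, every list containing one suitable index works. *)
Lemma finite_cover (S : topologicalType) (I : eqType) (A : set S)
    (f : I -> set S) :
  compact A -> (forall i, open (f i)) -> (forall x, A x -> exists i, f i x) ->
  exists s : seq I, forall x, A x -> exists2 i, i \in s & f i x.
Proof.
move=> /compact_near_coveringP cA fo Af.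
pose F := filter_from [set: seq I]
  (fun s0 => [set s : seq I | {subset s0 <= s}]).
have FF : Filter F.
  apply: filter_from_filter => [|s t _ _]; first by exists [::].
  exists (s ++ t) => // r str; split=> i ir; apply: str;
    by rewrite mem_cat ir ?orbT.
have [s0 _ s0A] : \forall s \near F,
    A `<=` (fun x => exists2 i, i \in s & f i x).
  apply: cA => x /Af[i fix_].
  exists (f i, [set s : seq I | {subset [:: i] <= s}]).
    split; last by exists [:: i].
    by apply: open_nbhs_nbhs; split=> /=; [exact: fo|].
  move=> [y s] [/= fiy si]; exists i => //.
  by apply: si; rewrite inE.
by exists s0; exact: s0A.
Qed.

(** The tube lemma: if the fibre over [p] misses [L], so do all nearby fibres, by compactness of
    [U]. *)
Lemma closed_fst_fiber (S U : topologicalType) (L : set (S * U)) (p : S) :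
  compact [set: U] -> closed L ->
  closure (fst @` L) p -> exists b, L (p, b).
Proof.
move=> /compact_near_coveringP cU Lc pL; apply: contrapT => noL.
have noLp : \forall a \near p, [set: U] `<=` (fun b => ~ L (a, b)).
  apply: cU => b _.
  have : nbhs (p, b) (~` L).
    apply: open_nbhs_nbhs; split; first by rewrite openC.
    by move=> Lpb; apply: noL; exists b.
  move=> [[V W] /= [Vp Wb] VWL]; exists (W, V) => //=.
  by move=> [b' a'] /= [Wb' Va']; exact: (VWL (a', b')).
have [_ [[[a b] Lab <-] /(_ b I)]] := pL _ noLp.
exact.
Qed.

End Topology.

(** * Integer powers of a homeomorphism *)

Section HomeoIter.
Context {X : topologicalType} (T : homeomorphism X).

Lemma homeo_iterS (n : int) (x : X) :
  homeo_iter T (n + 1) x = T (homeo_iter T n x).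
Proof.
case: n => [m|[|m]]; first by rewrite -PoszD addn1.
- by rewrite /= homeo_invK.
have -> : Negz m.+1 + 1 = Negz m by rewrite !NegzE -addn1 PoszD opprD addrNK.
by rewrite /= homeo_invK.
Qed.

Lemma homeo_iterD (m n : int) (x : X) :
  homeo_iter T (m + n) x = homeo_iter T m (homeo_iter T n x).
Proof.
elim/int_rec: m => [|m IH|m IH]; first by rewrite add0r.
  by rewrite -addn1 PoszD addrAC !homeo_iterS IH.
apply: (can_inj (homeo_funK T)); rewrite -!homeo_iterS.
by rewrite -addn1 PoszD opprD addrNK addrAC addrNK.
Qed.

Lemma homeo_iter_continuous (n : int) : continuous (homeo_iter T n).
Proof.
have iter_cont (f : X -> X) m : continuous f -> continuous (iter m f).
  move=> cf; elim: m => [|m IH]; first by move=> x U.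
  exact: (continuous_compose IH cf).
case: n => m; apply: iter_cont.
  exact: homeo_fun_continuous.
exact: homeo_inv_continuous.
Qed.

End HomeoIter.

(** * Cubes, face and diagonal actions, and parallelepipeds *)

Section Cubes.
Context {X : topologicalType} (T : homeomorphism X).

Unset Implicit Arguments.

(* [cube d] is X^[d], indexed by {0,1}^d: the two halves of [cube d.+1] are
   the faces where the last coordinate of the index is 0, respectively 1. *)
Fixpoint cube (d : nat) : topologicalType :=
  if d is d'.+1 then (cube d' * cube d')%type else X.

Fixpoint shift (d : nat) (k : int) : cube d -> cube d :=
  match d return cube d -> cube d with
  | 0 => homeo_iter T k
  | d'.+1 => fun a => (shift d' k a.1, shift d' k a.2)
  end.

(* The face transformation acting on the vertex [eps] by T^(n . eps). *)
Fixpoint face (d : nat) (n : nat -> int) : cube d -> cube d :=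
  match d return cube d -> cube d with
  | 0 => id
  | d'.+1 => fun a => (face d' n a.1, shift d' (n d') (face d' n a.2))
  end.

Fixpoint diag (d : nat) (x : X) : cube d :=
  match d return cube d with
  | 0 => x
  | d'.+1 => (diag d' x, diag d' x)
  end.

Fixpoint base (d : nat) : cube d -> X :=
  match d return cube d -> X with
  | 0 => id
  | d'.+1 => fun a => base d' a.1
  end.

Fixpoint set_base (d : nat) (x : X) : cube d -> cube d :=
  match d return cube d -> cube d with
  | 0 => fun=> x
  | d'.+1 => fun a => (set_base d' x a.1, a.2)
  end.

(** The index is a function on all of [nat], so it need not be restricted when passing to a face;
    only its values below [d] are read. *)
Fixpoint vertex (d : nat) (eps : nat -> bool) : cube d -> X :=
  match d return cube d -> X with
  | 0 => id
  | d'.+1 => fun a => vertex d' eps (if eps d' then a.2 else a.1)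
  end.

(* Q^[d]: the pairs below are (y, T^k y) with y in Q^[d-1]. *)
Fixpoint parallelepiped (d : nat) : set (cube d) :=
  match d return set (cube d) with
  | 0 => setT
  | d'.+1 => closure [set a : cube d' * cube d' |
      parallelepiped d' a.1 /\ exists k : int, a.2 = shift d' k a.1]
  end.

Set Implicit Arguments.

Lemma shift_continuous d k : continuous (shift d k).
Proof.
elim: d => [|d IH]; first exact: homeo_iter_continuous.
apply: continuous_pair.
  exact: continuous_compose (@continuous_fst _ _) IH.
exact: continuous_compose (@continuous_snd _ _) IH.
Qed.

Lemma face_continuous d n : continuous (face d n).
Proof.
elim: d => [|d IH]; first by move=> x U.
apply: continuous_pair.
  exact: continuous_compose (@continuous_fst _ _) IH.
apply: continuous_compose (@shift_continuous d (n d)).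
exact: continuous_compose (@continuous_snd _ _) IH.
Qed.

Lemma diag_continuous d : continuous (diag d).
Proof.
by elim: d => [|d IH]; [move=> x U|exact: continuous_pair].
Qed.

Lemma base_continuous d : continuous (base d).
Proof.
elim: d => [|d IH]; first by move=> x U.
exact: continuous_compose (@continuous_fst _ _) IH.
Qed.

Lemma set_base_continuous d x : continuous (set_base d x).
Proof.
elim: d => [|d IH]; first by move=> y; exact: cvg_cst.
apply: continuous_pair (@continuous_snd _ _).
exact: continuous_compose (@continuous_fst _ _) IH.
Qed.

Lemma vertex_continuous d eps : continuous (vertex d eps).
Proof.
elim: d => [|d IH]; first by move=> y U.
rewrite /=; case: (eps d).
  exact: continuous_compose (@continuous_snd _ _) IH.
exact: continuous_compose (@continuous_fst _ _) IH.
Qed.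

Lemma shiftD d j k a : shift d (j + k) a = shift d j (shift d k a).
Proof.
elim: d a => [|d IH] a /=; first exact: homeo_iterD.
by rewrite !IH.
Qed.

Lemma shift0 d a : shift d 0 a = a.
Proof. by elim: d a => [|d IH] //= [a b]; rewrite !IH. Qed.

Lemma shift_shiftC d j k a : shift d j (shift d k a) = shift d k (shift d j a).
Proof. by rewrite -!shiftD addrC. Qed.

Lemma face_shift d n k a : face d n (shift d k a) = shift d k (face d n a).
Proof. by elim: d a => [|d IH] //= a; rewrite !IH shift_shiftC. Qed.

Lemma faceD d m n a : face d (m + n) a = face d m (face d n a).
Proof. by elim: d a => [|d IH] //= a; rewrite !IH face_shift shiftD. Qed.

Lemma face0 d a : face d 0 a = a.
Proof. by elim: d a => [|d IH] //= [a b]; rewrite !IH shift0. Qed.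

Lemma eq_face d m n : (forall i, (i < d)%N -> m i = n i) ->
  face d m =1 face d n.
Proof.
elim: d => [|d IH] //= mn a.
by rewrite !IH ?mn // => i id; apply: mn; exact: ltnW.
Qed.

Lemma shift_diag d k x : shift d k (diag d x) = diag d (homeo_iter T k x).
Proof. by elim: d => [|d IH] //=; rewrite IH. Qed.

Lemma base_diag d x : base d (diag d x) = x.
Proof. by elim: d. Qed.

Lemma base_face d n a : base d (face d n a) = base d a.
Proof. by elim: d a => [|d IH] //= a; rewrite IH. Qed.

Lemma face_set_base d n x a :
  face d n (set_base d x a) = set_base d x (face d n a).
Proof. by elim: d a => [|d IH] //= a; rewrite IH. Qed.

Lemma set_base_set_base d x y a :
  set_base d x (set_base d y a) = set_base d x a.
Proof. by elim: d a => [|d IH] //= a; rewrite IH. Qed.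

Lemma base_set_base d x a : base d (set_base d x a) = x.
Proof. by elim: d a => [|d IH] //= a. Qed.

Lemma cube_compact d : compact [set: X] -> compact [set: cube d].
Proof.
move=> cX; elim: d => [|d IH] //=.
by rewrite -setXTT; exact: compact_setX.
Qed.

Lemma closed_parallelepiped d : closed (parallelepiped d).
Proof. by case: d => [|d]; [exact: closedT|exact: closed_closure]. Qed.

Lemma parallelepiped_graph d k a :
  parallelepiped d a -> parallelepiped d.+1 (a, shift d k a).
Proof. by move=> Qa; apply: subset_closure; split=> //; exists k. Qed.

Lemma parallelepiped_diag d x : parallelepiped d (diag d x).
Proof.
elim: d => [|d IH] //=.
by have := @parallelepiped_graph d 0 _ IH; rewrite shift0.
Qed.

Lemma shift_parallelepiped d k a :
  parallelepiped d a -> parallelepiped d (shift d k a).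
Proof.
elim: d k a => [|d IH] //= k a.
apply: closure_map (@shift_continuous d.+1 k) _ a => -[b c] /= [Qb [j ->]].
by rewrite shift_shiftC; apply: parallelepiped_graph; exact: IH.
Qed.

Lemma face_parallelepiped d n a :
  parallelepiped d a -> parallelepiped d (face d n a).
Proof.
elim: d a => [|d IH] //= a.
apply: closure_map (@face_continuous d.+1 n) _ a => -[b c] /= [Qb [j ->]].
by rewrite face_shift -shiftD; apply: parallelepiped_graph; exact: IH.
Qed.

Lemma parallelepiped_fst d a :
  parallelepiped d.+1 a -> parallelepiped d a.1.
Proof.
move=> Qa; apply: (@closed_parallelepiped d).
apply: closure_map (@continuous_fst _ _) _ a Qa => b [Qb _].
exact: subset_closure.
Qed.

Lemma parallelepiped_snd d a :
  parallelepiped d.+1 a -> parallelepiped d a.2.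
Proof.
move=> Qa; apply: (@closed_parallelepiped d).
apply: closure_map (@continuous_snd _ _) _ a Qa => b [Qb [k ->]].
by apply: subset_closure; exact: shift_parallelepiped.
Qed.

(** * Orbit closures under the face group and the full group *)

Definition face_orbit d (a : cube d) : set (cube d) :=
  [set c | exists n, c = face d n a].

Definition full_orbit d (a : cube d) : set (cube d) :=
  [set c | exists k n, c = shift d k (face d n a)].

Lemma closure_face_orbitS d (a b : cube d) :
  closure (face_orbit b) a ->
  closure (face_orbit a) `<=` closure (face_orbit b).
Proof.
move=> ba; apply: closure_trans => _ [n ->].
apply: closure_map (@face_continuous d n) _ a ba => _ [m ->].
by apply: subset_closure; exists (n + m); rewrite faceD.
Qed.

Lemma closure_full_orbitS d (a b : cube d) :
  closure (full_orbit b) a ->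
  closure (full_orbit a) `<=` closure (full_orbit b).
Proof.
move=> ba; apply: closure_trans => _ [k [n ->]].
have cf : continuous (shift d k \o face d n).
  exact: continuous_compose (@face_continuous d n) (@shift_continuous d k).
apply: closure_map cf _ a ba => _ [j [m ->]].
apply: subset_closure; exists (k + j), (n + m).
by rewrite /= face_shift -shiftD faceD.
Qed.

Lemma orbit_closure (Tmin : minimal_system T) (x y : X) :
  closure (orbit_of T x) y.
Proof.
move=> B; rewrite nbhsE => -[O [Oo Oy] OB].
have [||z [Oz xz]] := Tmin x O; [by exists y|by []|].
by exists z; split=> //; exact: OB.
Qed.

Lemma parallelepiped_full_orbit (Tmin : minimal_system T) d x :
  parallelepiped d `<=` closure (full_orbit (diag d x)).
Proof.
elim: d => [|d IH].
  move=> y _.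
  apply: (@closure_sub (cube 0) _ _ y (@orbit_closure Tmin x y)) => _ [k _ <-].
  by exists k, 0.
apply: closure_trans => -[a _] /= [/IH xa [j ->]].
have cf : continuous (fun c : cube d => (c, shift d j c)).
  by apply: continuous_pair (@shift_continuous d j) => c U.
apply: closure_map cf _ a xa => _ [k [n ->]].
apply: subset_closure.
(* The new last coordinate of the face vector supplies the relative shift [j] between the two
   halves. *)
exists k, (fun i => if i == d then j else n i); rewrite /= eqxx.
rewrite (@eq_face d _ n); first by rewrite shift_shiftC.
by move=> i; rewrite ltn_neqAle => /andP[/negbTE ->].
Qed.

(** * Recurrence to the diagonal *)

Definition diag_recurrent d := forall a, parallelepiped d a ->
  closure (face_orbit a) (diag d (base d a)).

(** Minimality of Q^[d] under the full group: the face orbit of [b] accumulates at a diagonal point,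
    whose full orbit is already dense. *)
Lemma full_orbit_dense (Tmin : minimal_system T) d b :
  diag_recurrent d -> parallelepiped d b ->
  parallelepiped d `<=` closure (full_orbit b).
Proof.
move=> Kd Qb; pose y := base d b.
apply: subset_trans (parallelepiped_full_orbit Tmin y) _.
apply: closure_full_orbitS; apply: (closure_sub (Kd _ Qb)) => _ [n ->].
by exists 0, n; rewrite shift0.
Qed.

(** Return times to [U] are syndetic. Face transformations fix the base vertex, so every point of
    the orbit closure has base [x] and is recurrent to [diag d x]; compactness makes finitely many
    return vectors suffice. *)
Lemma diag_syndetic (Xc : compact [set: X]) (Xh : hausdorff_space X) d x U :
  diag_recurrent d -> open U -> U (diag d x) ->
  exists D : seq (nat -> int),
    forall n, exists2 m, m \in D & U (face d (m + n) (diag d x)).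
Proof.
move=> Kd Uo Ux.
have cY : compact (closure (face_orbit (diag d x))).
  apply: subclosed_compact (@closed_closure _ _) (@cube_compact d Xc) _.
  by move=> c _.
have [|c Yc|D DU] := finite_cover (f := fun m => face d m @^-1` U) cY.
- by move=> m; apply: open_comp Uo => c _; exact: face_continuous.
- have Qc : parallelepiped d c.
    apply: (@closed_parallelepiped d); apply: (closure_sub Yc) => _ [n ->].
    by apply: face_parallelepiped; exact: parallelepiped_diag.
  have xc : base d c = x.
    apply: (accessible_closed_set1 (hausdorff_accessible Xh) (x := x)).
    apply: (closure_map (@base_continuous d) _ Yc) => _ [n ->].
    by apply: subset_closure; rewrite base_face base_diag.
  have Ubc : nbhs (diag d (base d c)) U by rewrite xc; exact: open_nbhs_nbhs.
  by have [_ [[m ->] Uc]] := Kd _ Qc U Ubc; exists m.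
exists D => n.
have [|m mD Um] := DU (face d n (diag d x)).
  by apply: subset_closure; exists n.
by exists m => //; rewrite faceD.
Qed.

(** The two moves differ only by a shift of the second half, so together they form one face
    transformation in dimension [d.+1]. *)
Lemma diag_pair_return (Tmin : minimal_system T) (Xc : compact [set: X])
    (Xh : hausdorff_space X) d x b U :
  diag_recurrent d -> parallelepiped d.+1 (diag d x, b) ->
  open U -> U (diag d x) ->
  exists n k, U (face d n (diag d x)) /\ U (shift d k (face d n b)).
Proof.
move=> Kd Qxb Uo Ux.
have Qb : parallelepiped d b := parallelepiped_snd Qxb.
have [D DU] := diag_syndetic Xc Xh Kd Uo Ux.
pose A := [set c | exists k n, U (face d n (diag d x)) /\
                               c = shift d k (face d n b)].
pose C := closure A.
have Cc : closed C := @closed_closure _ A.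
have C_shift k c : C c -> C (shift d k c).
  apply: closure_map (@shift_continuous d k) _ c => _ [j [n [Un ->]]].
  by apply: subset_closure; exists (k + j), n; rewrite shiftD.
pose P D := \big[setU/set0]_(m <- D) (face d m @^-1` C).
have PE E c : P E c <-> exists2 m, m \in E & C (face d m c).
  by rewrite /P -bigcup_seq; split=> -[m mE Cm]; exists m.
have Pc E : closed (P E).
  apply: closed_bigsetU => m _.
  by apply: preimage_closed Cc => y _; exact: face_continuous.
(* A point of [C] in the open set [U] is a limit of points of [A], one of which then lies in [U]. *)
suff [n Un Cn] : exists2 n, U (face d n (diag d x)) & C (face d n (diag d x)).
  have [_ [[k [m [Um ->]]] Uk]] := Cn _ (open_nbhs_nbhs (conj Uo Un)).
  by exists m, k.
(* On the dense full orbit of [b], a return vector [m] for [n] sends [shift d k (face d n b)] into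
   [A]; [P D] is closed. *)
have : parallelepiped d `<=` P D.
  move=> c /(full_orbit_dense Tmin Kd Qb) bc.
  apply: (Pc D); apply: (closure_sub bc) => _ [k [n ->]].
  have [m mD Um] := DU n.
  apply/PE; exists m => //; rewrite face_shift -faceD.
  by apply: subset_closure; exists k, (m + n).
(* Translates are dropped while the others still cover; [b] prevents the list from becoming empty.
   When [m0] cannot be dropped, [O] meets Q^[d], and there [face d m0] maps [O] into [C]. *)
elim: D {DU} => [/(_ _ Qb)/PE[]//|m0 D IH cov].
have [/IH//|] := pselect (parallelepiped d `<=` P D).
move=> /existsNP[c /not_implyP[Qc Oc]].
pose O := ~` P D.
have Oo : open O by rewrite openC.
have O_shift k y : O (shift d k y) -> O y.
  move=> Oy /PE[m mD Cm]; apply: Oy; apply/PE; exists m => //.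
  by rewrite face_shift; exact: C_shift.
have OC y : parallelepiped d y -> O y -> C (face d m0 y).
  move=> Qy Oy; have /PE[m] := cov _ Qy.
  by rewrite inE => /orP[/eqP ->//|mD Cm]; case: Oy; apply/PE; exists m.
have [n Un On] : exists2 n, U (face d n (diag d x)) & O (face d (n - m0) b).
  pose B := [set c | exists k n, U (face d n (diag d x)) /\
                                 c = shift d k (face d (n - m0) b)].
  (* [B] is [A] moved by [- m0], and [face d m0 c] lies in [C]. *)
  have Bc : closure B c.
    rewrite -[c](@face0 d) -(addNr m0) faceD.
    apply: (closure_map (@face_continuous d (- m0)) _ (OC _ Qc Oc)).
    move=> _ [k [n [Un ->]]]; apply: subset_closure; exists k, n.
    by rewrite face_shift -faceD addrC.
  have [_ [[k [n [Un ->]]] /O_shift On]] := Bc _ (open_nbhs_nbhs (conj Oo Oc)).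
  by exists n.
exists n => //; apply: contrapT => nC.
(* If [face d n (diag d x)] avoided [C], the open conditions in [W] would hold at some graph pair
   [(y, shift d j y)] near [(diag d x, b)]; the invariance of [O] then contradicts [OC]. *)
pose W := [set a : cube d * cube d |
  (~` C) (face d n a.1) /\ O (face d (n - m0) a.2)].
have Wo : open W.
  apply: openI.
    apply: (open_comp (f := face d n \o fst)); last by rewrite openC.
    move=> a _.
    exact: continuous_compose (@continuous_fst _ _) (@face_continuous d n) a.
  apply: (open_comp (f := face d (n - m0) \o snd)); last exact: Oo.
  move=> a _.
  exact: continuous_compose (@continuous_snd _ _)
    (@face_continuous d (n - m0)) a.
have nW : nbhs ((diag d x, b) : cube d.+1) W by apply: open_nbhs_nbhs; split.
have [[y _] [[/= Qy [j ->]] [/= Cy]]] := Qxb W nW.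
rewrite face_shift => /O_shift Oy; apply: Cy.
by have := OC _ (face_parallelepiped _ Qy) Oy; rewrite -faceD addrC subrK.
Qed.

Lemma parallelepiped_recurrent (Tmin : minimal_system T)
    (Xc : compact [set: X]) (Xh : hausdorff_space X) d : diag_recurrent d.
Proof.
elim: d => [|d Kd] a Qa; first by apply: subset_closure; exists 0.
pose x := base d a.1.
(* The first half is brought to the diagonal by recurrence in dimension [d]; compactness provides a
   limit [b] for the second half. *)
have [b Lb] : exists b, closure (face_orbit a) (diag d x, b).
  apply: closed_fst_fiber (@closed_closure _ _) _; first exact: cube_compact.
  apply: (closure_sub (Kd _ (parallelepiped_fst Qa))) => _ [n ->].
  by exists (face d.+1 n a) => //; apply: subset_closure; exists n.
have Qb : parallelepiped d.+1 (diag d x, b).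
  apply: (@closed_parallelepiped d.+1); apply: (closure_sub Lb) => _ [n ->].
  exact: face_parallelepiped.
apply: (closure_face_orbitS Lb) => B [[V W] /= [Vx Wx] VWB].
have Ux : (interior (V `&` W)) (diag d x) by exact: filterI.
have [n [k [Un Uk]]] :=
  diag_pair_return Tmin Xc Xh Kd Qb (@open_interior _ _) Ux.
have [Vn _] := interior_subset Un.
have [_ Wk] := interior_subset Uk.
pose m i := if i == d then k else n i.
exists (face d.+1 m (diag d x, b)); split; first by exists m.
have md : m d = k by rewrite /m eqxx.
have mn i : (i < d)%N -> m i = n i.
  by rewrite ltn_neqAle /m => /andP[/negbTE ->].
by apply: VWB; rewrite /= md !(eq_face mn).
Qed.

(** * Coordinates of cubes and neighbourhoods of diagonal points *)

Lemma vertex_shift d eps k a :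
  vertex d eps (shift d k a) = homeo_iter T k (vertex d eps a).
Proof. by elim: d a => [|d IH] //= a; rewrite -IH; case: (eps d). Qed.

Lemma vertex_face d eps n a : vertex d eps (face d n a) =
  homeo_iter T (\sum_(i < d) n i * (eps i)%:Z) (vertex d eps a).
Proof.
elim: d a => [|d IH] a; first by rewrite big_ord0.
rewrite big_ord_recr /=; case: (eps d); last by rewrite mulr0 addr0.
by rewrite vertex_shift IH mulr1 addrC homeo_iterD.
Qed.

Lemma vertex_diag d eps x : vertex d eps (diag d x) = x.
Proof. by elim: d => [|d IH] //=; case: (eps d). Qed.

Lemma eq_vertex d eps eps' a : (forall i, (i < d)%N -> eps i = eps' i) ->
  vertex d eps a = vertex d eps' a.
Proof.
elim: d a => [|d IH] //= a e; rewrite e //.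
by apply: IH => i id; apply: e; exact: ltnW.
Qed.

Lemma vertex_set_base d (eps : nat -> bool) x a :
  (exists2 i, (i < d)%N & eps i) ->
  vertex d eps (set_base d x a) = vertex d eps a.
Proof.
elim: d a => [|d IH] a; first by case.
move=> [i id ei] /=; case: ifPn => // ed; apply: IH; exists i => //.
move: id; rewrite ltnS leq_eqVlt => /orP[/eqP ide|//].
by rewrite -ide ei in ed.
Qed.

Lemma cube_eqP d (a b : cube d) :
  (forall eps, vertex d eps a = vertex d eps b) -> a = b.
Proof.
elim: d a b => [|d IH]; first by move=> a b /(_ (fun=> true)).
move=> [a1 a2] [b1 b2] /= ab; congr pair; apply: IH => eps.
  (* Forcing the value at [d] to false, then to true below, selects the first and the second half
     without changing the index inside it. *)
  have ee i : (i < d)%N -> (i != d) && eps i = eps i.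
    by rewrite ltn_neqAle => /andP[->].
  by have := ab (fun i => (i != d) && eps i); rewrite eqxx /= !(eq_vertex _ ee).
have ee i : (i < d)%N -> (i == d) || eps i = eps i.
  by rewrite ltn_neqAle => /andP[/negbTE ->].
by have := ab (fun i => (i == d) || eps i); rewrite eqxx /= !(eq_vertex _ ee).
Qed.

Lemma base_vertex d a : base d a = vertex d (fun=> false) a.
Proof. by elim: d a => [|d IH] //= a. Qed.

Lemma set_base_eq d (a b : cube d) :
  (forall eps : nat -> bool, (exists2 i, (i < d)%N & eps i) ->
    vertex d eps a = vertex d eps b) ->
  a = set_base d (base d a) b.
Proof.
move=> ab; apply: cube_eqP => eps.
have [e|e] := pselect (exists2 i, (i < d)%N & eps i).
  by rewrite vertex_set_base // ab.
have e0 i : (i < d)%N -> eps i = (fun=> false) i.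
  by move=> id; apply/negbTE/negP => ei; apply: e; exists i.
by rewrite !(eq_vertex _ e0) -!base_vertex base_set_base.
Qed.

Fixpoint box (d : nat) (B : set X) : set (cube d) :=
  match d return set (cube d) with
  | 0 => B
  | d'.+1 => fun a => @box d' B a.1 /\ @box d' B a.2
  end.

Lemma nbhs_box d (B : set X) x : nbhs x B -> nbhs (diag d x) (@box d B).
Proof.
move=> Bx; elim: d => [|d IH] //=.
by exists (@box d B, @box d B); [split|case].
Qed.

Lemma box_vertex d (B : set X) a eps : @box d B a -> B (vertex d eps a).
Proof.
by elim: d a => [|d IH] //= a [Ba1 Ba2]; case: ifP => _; exact: IH.
Qed.

End Cubes.

(** * Regional proximality in terms of face orbits *)

Section RegionallyProximal.
Context {R : realType} {X : metricType R} (T : homeomorphism X).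

Lemma mdist_split (x y z : X) (e : R) :
  mdist x y < e / 2 -> mdist y z < e / 2 -> mdist x z < e.
Proof.
move=> xy yz; rewrite (splitr e).
exact: le_lt_trans (metric_triangle x y z) (ltrD xy yz).
Qed.

Lemma cluster_mdist (Z : topologicalType) (F : set_system Z) (c : Z)
    (g h : Z -> X) : cluster F c -> continuous g -> continuous h ->
  (forall e : R, 0 < e -> F [set z | mdist (g z) (h z) < e]) -> g c = h c.
Proof.
move=> Fc cg ch Fgh; apply: contrapT => /eqP; rewrite -mdist_gt0.
set e := mdist _ _ => e0.
have near_c (f : Z -> X) (r : R) : continuous f -> 0 < r ->
    nbhs c [set z | mdist (f c) (f z) < r].
  by move=> cf r0; have := cf c _ (nbhsx_ballx (f c) r r0); rewrite ballEmdist.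
have e2 : 0 < e / 2 by rewrite divr_gt0.
have e4 : 0 < e / 2 / 2 by rewrite divr_gt0.
(* The distance is split as e/4 + e/4 + e/2, through [g z] and then [h z]. *)
have [z [/= gh [gz hz]]] :=
  Fc _ _ (Fgh _ e4) (filterI (near_c g _ cg e4) (near_c h _ ch e2)).
have := mdist_split (mdist_split gz gh); rewrite metric_sym in hz.
by move=> /(_ _ hz); rewrite ltxx.
Qed.

(** The witnesses for each [delta] give cubes whose halves are [delta]-close off the base vertex; at
    a cluster point the halves agree there exactly. *)
Lemma RP_parallelepiped (Tmin : minimal_system T) (Xc : compact [set: X])
    d (x y : X) : RP T d x y ->
  exists2 q : cube d, parallelepiped T d.+1 (set_base d x q, q) & base d q = y.
Proof.
move=> xy.
pose G (e : R) := [set c : cube d.+1 | [/\ parallelepiped T d.+1 c,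
  mdist x (base d c.1) < e, mdist y (base d c.2) < e &
  forall eps : nat -> bool, (exists2 i, (i < d)%N & eps i) ->
    mdist (vertex d eps c.1) (vertex d eps c.2) < e]].
pose F := filter_from [set e : R | 0 < e] G.
have FF : ProperFilter F.
  apply: filter_from_proper.
    apply: filter_from_filter; first by exists 1 => /=.
    move=> e1 e2 /= e10 e20; exists (Num.min e1 e2) => /=.
      by rewrite lt_min e10.
    move=> c [Qc]; rewrite !lt_min => /andP[x1 x2] /andP[y1 y2] eps12.
    by split; split=> // eps /eps12; rewrite lt_min => /andP[].
  move=> e /xy [x' [y' [n [xx' yy' n_close]]]].
  (* [n] is extended by 0; the value 0 at [d] makes [m'] act identically on both halves. *)
  pose m i := if insub i is Some j then n j else 0.
  pose m' i := if i == d then 0 else m i.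
  exists (face T d.+1 m' (diag d x', diag d y')).
  have m'd : m' d = 0 by rewrite /m' eqxx.
  have m'm i : (i < d)%N -> m' i = m i.
    by rewrite ltn_neqAle /m' => /andP[/negbTE ->].
  split.
  - apply: face_parallelepiped; apply: (@closed_parallelepiped _ T d.+1).
    (* By minimality [y'] is a limit of points of the orbit of [x'], so the pair of diagonals is a
       limit of graph pairs. *)
    have c2 := @continuous_pair X _ _ (cst (diag d x')) (diag d)
      (@cst_continuous _ _ _) (@diag_continuous X d).
    apply: (@closure_map X (cube d.+1) _ _ _ c2 _ y'
      (@orbit_closure _ T Tmin x' y')) => _ [k _ <-].
    apply: subset_closure; rewrite -shift_diag.
    by apply: parallelepiped_graph; exact: parallelepiped_diag.
  - by rewrite /= base_face base_diag.
  - by rewrite /= m'd shift0 base_face base_diag.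
  move=> eps [i id ei]; rewrite /= m'd shift0 !(eq_face _ m'm).
  rewrite !vertex_face !vertex_diag.
  pose f := [ffun j : 'I_d => eps j].
  have -> : \sum_(j < d) m j * (eps j)%:Z = cube_dot n f.
    by apply: eq_bigr => j _; rewrite /m valK ffunE.
  apply: n_close; apply/eqP => /ffunP/(_ (Ordinal id)).
  by rewrite !ffunE /= ei.
have [c [_ Fc]] := cube_compact Xc FF (filterT : F [set: cube d.+1]).
have GF e (P : set (cube d.+1)) : 0 < e -> G e `<=` P -> F P.
  by move=> e0 GP; exists e.
have c1 : x = base d c.1.
  apply: (cluster_mdist (g := cst x) (h := base d.+1) Fc).
  - exact: cst_continuous.
  - exact: base_continuous.
  - by move=> e e0; apply: GF e0 _ => z [].
have c2 : y = base d c.2.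
  apply: (cluster_mdist (g := cst y) (h := base d \o snd) Fc).
  - exact: cst_continuous.
  - exact: continuous_compose (@continuous_snd _ _) (@base_continuous X d).
  - by move=> e e0; apply: GF e0 _ => z [].
exists c.2; last by [].
suff -> : set_base d x c.2 = c.1.
  apply: (@closed_parallelepiped _ T d.+1) => B cB.
  rewrite -[X in nbhs X](surjective_pairing c) in cB.
  by apply: Fc cB; apply: GF ltr01 _ => z [].
rewrite c1 -set_base_eq // => eps epsd.
apply: (cluster_mdist (g := vertex d eps \o fst) (h := vertex d eps \o snd) Fc).
- exact: continuous_compose (@continuous_fst _ _) (@vertex_continuous X d eps).
- exact: continuous_compose (@continuous_snd _ _) (@vertex_continuous X d eps).
- by move=> e e0; apply: GF e0 _ => z [_ _ _ /(_ _ epsd)].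
Qed.

Lemma RP_face_orbit (Tmin : minimal_system T) (Xc : compact [set: X])
    d (x y : X) : RP T d x y ->
  closure (face_orbit T (set_base d.+1 x (diag d.+1 y))) (diag d.+1 x).
Proof.
have Xh : hausdorff_space X by exact: metric_hausdorff.
have K := parallelepiped_recurrent Tmin Xc Xh.
move=> /(RP_parallelepiped Tmin Xc)[q Qq qy].
have := K d.+1 (set_base d.+1 x (diag d.+1 y)); rewrite base_set_base; apply.
apply: (@closed_parallelepiped _ T d.+1).
(* Recurrence of [q] to [diag d y] is transported by [z => (set_base d x z, z)], which commutes with
   face transformations moving both halves alike. *)
have c2 : continuous (fun z => (set_base d x z, z)).
  by apply: continuous_pair (@set_base_continuous X d x) _ => z U.
have yq := K _ _ (parallelepiped_snd Qq); rewrite qy in yq.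
apply: (closure_map c2 _ yq) => _ [n ->]; apply: subset_closure.
pose m i := if i == d then 0 else n i.
have md : m d = 0 by rewrite /m eqxx.
have mn i : (i < d)%N -> m i = n i.
  by rewrite ltn_neqAle /m => /andP[/negbTE ->].
have := @face_parallelepiped _ T d.+1 m _ Qq.
by rewrite /= md shift0 !(eq_face _ mn) face_set_base.
Qed.

Lemma face_orbit_RP d (x y : X) :
  closure (face_orbit T (set_base d.+1 y (diag d.+1 x))) (diag d.+1 y) ->
  RP T d x y.
Proof.
move=> xy e e0.
have e20 : 0 < e / 2 by rewrite divr_gt0.
have yB : nbhs y [set z | mdist y z < e / 2].
  by rewrite -(ballEmdist y); exact: nbhsx_ballx.
have [_ [[n ->] /box_vertex nB]] := xy _ (nbhs_box d.+1 yB).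
have close (eps : nat -> bool) : (exists2 i, (i < d.+1)%N & eps i) ->
    mdist y (homeo_iter T (\sum_(i < d.+1) n i * (eps i)%:Z) x) < e / 2.
  move=> h; have := nB eps.
  by rewrite vertex_face vertex_set_base // vertex_diag.
(* The vertex whose only nonzero coordinate is [d] shows that [T^(n d) x] is close to [y]; the other
   entries of [n] form the required vector. *)
exists x, (homeo_iter T (n d) x), [ffun j : 'I_d => n j]; split.
- by rewrite mdistxx.
- have := close (fun i => i == d); rewrite big_ord_recr /= eqxx big1.
    rewrite add0r mulr1 => h; apply: lt_trans (h _) _; first by exists d.
    by rewrite ltr_pdivrMr // ltr_pMr // ltr1n.
  by move=> i _; rewrite ltn_eqF // mulr0.
move=> eps eps0.
(* [f b] extends [eps] by [b] at [d]: the two values of [b] place the images of both witnesses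
   within e/2 of [y]. *)
pose f b i := if insub i is Some j then eps j else b.
have [j ej] : exists j, eps j.
  apply: contrapT => h; move/eqP: eps0; apply; apply/ffunP => j.
  by rewrite ffunE; apply/negbTE/negP => ej; apply: h; exists j.
have fj b (i : 'I_d) : f b i = eps i by rewrite /f valK.
have fd b : f b d = b by rewrite /f insubF // ltnn.
have dotE : cube_dot [ffun j : 'I_d => n j] eps =
    \sum_(i < d) n i * (eps i)%:Z.
  by apply: eq_bigr => i _; rewrite ffunE.
have f_close (b : bool) : mdist y (homeo_iter T
    (cube_dot [ffun j : 'I_d => n j] eps + n d * b%:Z) x) < e / 2.
  have := close (f b); rewrite big_ord_recr /= fd dotE.
  under eq_bigr do rewrite fj.
  by apply; exists j; [rewrite ltnS ltnW|rewrite fj].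
apply: (@mdist_split _ y).
  by rewrite metric_sym; have := f_close false; rewrite mulr0 addr0.
by have := f_close true; rewrite mulr1 homeo_iterD.
Qed.

Lemma RP_refl d (x : X) : RP T d x x.
Proof.
by move=> e e0; exists x, x, [ffun=> 0]; split=> [||eps _]; rewrite mdistxx.
Qed.

Lemma RP_sym d (x y : X) : RP T d x y -> RP T d y x.
Proof.
move=> xy e /xy [x' [y' [n [xx' yy' n_close]]]].
by exists y', x', n; split=> // eps /n_close; rewrite metric_sym.
Qed.

(** The base vertex is inert under face transformations, so the approximation of (y, y, ..., y) from
    (y, x, ..., x) also leads from (z, x, ..., x) to (z, y, ..., y), and from there to (z, ...,
    z). *)
Lemma RP_trans (Tmin : minimal_system T) (Xc : compact [set: X])
    d (x y z : X) : RP T d x y -> RP T d y z -> RP T d x z.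
Proof.
move=> /RP_sym /(RP_face_orbit Tmin Xc) yx /RP_sym /(RP_face_orbit Tmin Xc) zy.
apply: face_orbit_RP; apply: (closure_face_orbitS _ zy).
apply: (closure_map (@set_base_continuous X d.+1 z) _ yx) => _ [n ->].
apply: subset_closure; exists n.
by rewrite -face_set_base set_base_set_base.
Qed.

End RegionallyProximal.

Theorem theorem3p3 (R : realType) (X : metricType R) (T : homeomorphism X)
    (d : nat) (Xcompact : compact [set: X]) (Tmin : minimal_system T)
    (d_ge1 : (1 <= d)%N) :
  RelationClasses.Equivalence (RP T d).
Proof.
split.
- by move=> x; exact: RP_refl.
- by move=> x y; exact: RP_sym.
- by move=> x y z; exact: RP_trans.
Qed.
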